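(* Let $N$ be an abelian normal subgroup of a finite group $G$. Then a commuting automorphism $\phi$ of $G/N$ lifts to an automorphism of $G$ centralizing $N$ if and only if the restriction of $\phi$ to each Sylow subgroup $P/N$ of $G/N$ lifts to an automorphism of $P$ centralizing $N$.
   Context: An automorphism $\alpha$ of a group $K$ is called a commuting automorphism if $x\,\alpha(x)=\alpha(x)\,x$ for all $x\in K$. For a subgroup $P$ with $N\le P\le G$ and an automorphism $\phi$ of $G/N$, ''the restriction of $\phi$ to $P/N$ lifts to an automorphism of $P$ centralizing $N$'' means that $\phi(P/N)=P/N$ and there is an automorphism $\gamma$ of $P$ with $\gamma(n)=n$ for all $n\in N$ and $\gamma(g)N=\phi(gN)$ for all $g\in P$. The case $P=G$ gives the meaning of ''$\phi$ lifts to an automorphism of $G$ centralizing $N$''. *)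

(* Defs.v *)
From mathcomp Require Import all_boot all_fingroup all_solvable.

Set Implicit Arguments.
Unset Strict Implicit.
Unset Printing Implicit Defensive.

Local Open Scope group_scope.

(* An automorphism of a subgroup K is an element of [Aut K]: a permutation of
   the ambient type that is a morphism on K and the identity outside K; such
   permutations correspond bijectively to the automorphisms of K. *)

Definition commuting_aut (gT : finGroupType) (K : {group gT})
    (phi : {perm gT}) : Prop :=
  phi \in Aut K /\ {in K, forall x, commute x (phi x)}.

(* Intended for N <| G, N \subset P \subset G and phi \in Aut (G / N).  Then
   P and gamma @: P lie in 'N(N), so that [coset N g] and [coset N (gamma g)]
   are the actual cosets gN and gamma(g)N. *)
Definition restriction_lifts (gT : finGroupType) (N P : {group gT})
    (phi : {perm coset_of N}) : Prop :=
  phi @: (P / N) = (P / N) /\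
  exists gamma : {perm gT},
    [/\ gamma \in Aut P,
        {in N, forall n, gamma n = n} &
        {in P, forall g, coset N (gamma g) = phi (coset N g)}].

(* Main.v *)
(* If a is a commuting automorphism of K then [a x, y] = [x, a y]; expanding
   this at y * z shows that a z * z^-1 centralizes K', and C_K(K') is normal and
   nilpotent of class at most 2.  Hence for a p-element z the p-element
   a z * z^-1 lies in O_p(K), and a stabilizes every Sylow subgroup of K: lifts
   to G restrict to lifts to P.

   Conversely, lifts to the Sylow subgroups show that phi is compatible with the
   conjugation action on N.  The defect of multiplicativity of a set-theoretic
   lift of phi is then an N-valued 2-cocycle whose class c does not depend on the
   lift, and phi lifts to G iff c = 0.  Extending a lift on P over the cosets of
   P makes the defect f satisfy f (p x) y = f x y for p in P, so summing the
   cocycle identity over these cosets gives #|G : P| c = 0; the indices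
   #|G : P| have no common prime factor, so c = 0. *)
Require Import Defs.
From mathcomp Require Import all_boot all_fingroup all_solvable ssralg.

Set Implicit Arguments.
Unset Strict Implicit.
Unset Printing Implicit Defensive.

Local Open Scope group_scope.

(** * Commuting automorphisms and Sylow subgroups *)

Section CommutingAut.

Variables (gT : finGroupType) (K : {group gT}) (a : {perm gT}).
Hypothesis aC : commuting_aut K a.

Let AutKa : a \in Aut K. Proof. by case: aC. Qed.
Let aK x : x \in K -> a x \in K. Proof. exact: Aut_closed. Qed.
Let aM : {in K &, {morph a : x y / x * y}}.
Proof. exact: morphicP (Aut_morphic AutKa). Qed.
Let aV x : x \in K -> a x^-1 = (a x)^-1.
Proof. by move=> Kx; rewrite -(autmE AutKa) morphV. Qed.

(** With [z = y^-1], this is the commutation of [x * z] with its image, multiplied out by [a x * x]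
    on the left and [z * a z] on the right. *)
Lemma commuting_aut_commg : {in K &, forall x y, [~ a x, y] = [~ x, a y]}.
Proof.
move=> x y Kx Ky; rewrite -[y]invgK; set z := y^-1.
have Kz : z \in K by rewrite groupV.
rewrite aV //; have [_ cK] := aC; have cx : x * a x = a x * x by apply: cK.
have cz : z * a z = a z * z by apply: cK.
have cxz : x * z * (a x * a z) = a x * a z * (x * z).
  by rewrite -aM //; apply/cK/groupM.
rewrite !commgEl !conjgE !invgK.
apply: (mulgI (a x * x)); rewrite -{1}cx -!mulgA mulKVg mulKVg.
apply: (mulIg (z * a z)); rewrite {2}cz -!mulgA !mulKg (mulKVg y).
by rewrite -!mulgA in cxz.
Qed.

Lemma commuting_aut_der1_cent x : x \in K -> a x * x^-1 \in 'C_K(K^`(1)).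
Proof.
move=> Kx; rewrite inE groupM ?groupV ?aK //=.
rewrite cent_gen; apply/centP => _ /imset2P[y z Ky + ->].
(* By surjectivity of [a], the commutators [[~ y, a w]] generate K'. Expanding at [w * x] shows that
   [x] and [a x] conjugate each of them alike. *)
rewrite -{1}(im_autm AutKa) => /morphimP[w Kw _ ->] /=.
have := commuting_aut_commg Ky (groupM Kw Kx).
rewrite aM // !commgMJ !commuting_aut_commg // => /mulgI cJ.
by apply/commute_sym/commgP/conjg_fixP; rewrite conjgM -[_ ^ a x]cJ conjgK.
Qed.

(** The derived subgroup of C = C_K(K') lies in K', which C centralizes; so C / Z(C) is abelian. *)
Lemma nilpotent_cent_der1 : nilpotent 'C_K(K^`(1)).
Proof.
rewrite -quotient_center_nil; apply: abelian_nil; apply: sub_der1_abelian.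
rewrite subsetI der_sub /=; apply: subset_trans (dergS 1 (subsetIl _ _)) _.
by rewrite centsC subsetIr.
Qed.

Lemma commuting_aut_Sylow p (S : {group gT}) :
  p.-Sylow(K) S -> a @: S = S.
Proof.
move=> sylS; have sSK := pHall_sub sylS; have pS := pHall_pgroup sylS.
apply/eqP; rewrite eqEcard card_imset ?leqnn ?andbT; last exact: perm_inj.
apply/subsetP=> _ /imsetP[x Sx ->]; have Kx := subsetP sSK x Sx.
rewrite -[a x](mulgKV x) groupM //.
have nC : 'C_K(K^`(1)) <| K.
  by rewrite /normal subsetIl normsI ?normG ?norms_cent ?der_norm.
have p_d : p.-elt (a x * x^-1).
  apply: p_eltM; last by rewrite p_eltV (mem_p_elt pS).
    by apply/commuteV/commute_sym; case: aC => _; apply.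
  by rewrite -(autmE AutKa) morph_p_elt // (mem_p_elt pS).
(* In the nilpotent normal subgroup C_K(K') every p-element lies in the p-core, which is contained
   in O_p(K), hence in [S]. *)
have hC := nilpotent_pcore_Hall p nilpotent_cent_der1.
have dC := commuting_aut_der1_cent Kx.
rewrite -(mem_Hall_pcore hC dC) in p_d.
apply: subsetP p_d; apply: subset_trans (pcore_sub_Hall sylS).
by rewrite pcore_max ?pcore_pgroup // (char_normal_trans (pcore_char _ _)).
Qed.

End CommutingAut.

(** * Lifts and the conjugation action on N *)

Section Lifting.

Variables (gT : finGroupType) (G N : {group gT}).
Hypotheses (abN : abelian N) (nNG : N <| G).
Variable phi : {perm coset_of N}.
Hypothesis AutKphi : phi \in Aut (G / N).

Implicit Types (x y z n : gT) (P : {group gT}) (g : gT -> gT).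

Let sNG : N \subset G. Proof. exact: normal_sub. Qed.
Let nG x : x \in G -> x \in 'N(N).
Proof. exact/subsetP/normal_norm. Qed.
Let NG n : n \in N -> n \in G. Proof. exact/subsetP. Qed.

Let phiM : {in G &, forall x y,
  phi (coset N (x * y)) = phi (coset N x) * phi (coset N y)}.
Proof.
move=> x y Gx Gy; rewrite morphM ?nG //.
by rewrite (morphicP (Aut_morphic AutKphi)) ?mem_quotient.
Qed.

Let phi1 : phi 1 = 1.
Proof. by rewrite -(autmE AutKphi) morph1. Qed.

(** Bijectivity is automatic: since [phi] is injective, the kernel of [f] lies in [N], where [f] is
    the identity. *)
Lemma restriction_lifts_intro P (f : gT -> gT) :
    N \subset P -> P \subset G ->
    {in P &, {morph f : x y / x * y}} -> {in P, forall x, f x \in P} ->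
    {in N, forall n, f n = n} ->
    {in P, forall x, coset N (f x) = phi (coset N x)} ->
  restriction_lifts P phi.
Proof.
move=> sNP sPG fM fP fN fphi; pose fm := Morphism fM.
have injf : 'injm fm.
  apply/subsetP=> x /morphpreP[Px /set1P /= fx1]; rewrite inE.
  have := fphi x Px; rewrite fx1 morph1 -phi1 => /perm_inj/esym cx1.
  by rewrite -(fN x) ?fx1 // coset_idr ?nG // (subsetP sPG).
have imf : fm @* P = P.
  apply/(morphim_fixP injf)=> //; apply/subsetP=> _ /morphimP[x _ Px ->].
  exact: fP.
have autf : {in P, aut injf imf =1 f} by exact: autE.
split.
  apply/eqP; rewrite eqEcard card_imset ?leqnn ?andbT; last exact: perm_inj.
  apply/subsetP=> _ /imsetP[_ /morphimP[x _ Px ->] ->] /=.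
  by rewrite -fphi // mem_quotient ?fP.
exists (aut injf imf); split=> [|n Nn|x Px]; first exact: Aut_aut.
  by rewrite autf ?fN // (subsetP sNP).
by rewrite autf ?fphi.
Qed.

Lemma eq_coset_conj y z n : y \in G -> z \in G -> n \in N ->
  coset N y = coset N z -> n ^ y = n ^ z.
Proof.
move=> Gy Gz Nn /rcoset_kercosetP; rewrite !nG // => /(_ isT isT).
by case/rcosetP=> m Nm ->; rewrite conjgM (conjgE n m) (centsP abN n) ?mulKg.
Qed.

Lemma restriction_lifts_conj P x y n :
    N \subset P -> P \subset G -> restriction_lifts P phi ->
    x \in P -> y \in G -> coset N y = phi (coset N x) -> n \in N ->
  n ^ y = n ^ x.
Proof.
move=> sNP sPG [_ [c [AutPc cN cphi]]] Px Gy yphi Nn.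
have Gx := subsetP sPG x Px; have Pn := subsetP sNP n Nn.
have Pcx : c x \in P by apply: Aut_closed.
rewrite (@eq_coset_conj y (c x)) ?cphi ?(subsetP sPG (c x)) //.
(* The lift fixes both [n] and [n ^ x], so [c x] and [x] act alike on [n]. *)
have cJ : c (n ^ x) = c n ^ c x by apply: (morphJ (autm_morphism AutPc)).
by rewrite -{1}(cN n) // -cJ cN // memJ_norm ?nG.
Qed.

Definition conj_compatible :=
  forall x y n, x \in G -> y \in G -> coset N y = phi (coset N x) ->
  n \in N -> n ^ y = n ^ x.

Lemma mem_coset_lift x : x \in G ->
  repr (phi (coset N x)) \in G /\
  coset N (repr (phi (coset N x))) = phi (coset N x).
Proof.
move=> Gx; split; last exact: coset_reprK.
rewrite -(quotientGK nNG) mem_morphpre ?repr_coset_norm //= coset_reprK.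
by rewrite Aut_closed ?mem_quotient.
Qed.

Lemma Sylow_quotient_lift p : exists P : {group gT},
  [/\ N \subset P, P \subset G, p.-Sylow(G / N) (P / N) & p^'.-nat #|G : P|].
Proof.
have [S sylS] := Sylow_exists p (G / N).
have [P defS sNP sPG] := inv_quotientS nNG (pHall_sub sylS).
exists P; rewrite -defS; split=> //; case/and3P: sylS => _ _.
by rewrite defS index_quotient_eq ?subIset ?sNP ?orbT ?normal_norm.
Qed.

(** The elements [x] satisfying the condition form a subgroup [H]. A prime dividing its index would
    divide the index of some [P] contained in [H] that covers a Sylow subgroup of G / N for that
    prime, which is impossible. *)
Lemma conj_compatible_Sylow :
    (forall p P, prime p -> N \subset P -> P \subset G ->
       p.-Sylow(G / N) (P / N) -> restriction_lifts P phi) ->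
  conj_compatible.
Proof.
move=> liftP.
pose s x := repr (phi (coset N x)).
pose H := [set x in G | [forall n in N, n ^ s x == n ^ x]].
have Hgroup : group_set H.
  apply/group_setP; split=> [|x y].
    rewrite inE group1; apply/forall_inP=> n Nn.
    by rewrite /s coset_id ?phi1 ?repr_coset1.
  rewrite !inE => /andP[Gx /forall_inP Hx] /andP[Gy /forall_inP Hy].
  rewrite groupM //; apply/forall_inP=> n Nn.
  have [Gsx sx] := mem_coset_lift Gx; have [Gsy sy] := mem_coset_lift Gy.
  have [Gsxy sxy] := mem_coset_lift (groupM Gx Gy).
  rewrite (@eq_coset_conj _ (s x * s y)) ?groupM //.
    rewrite !conjgM (eqP (Hx _ Nn)) (eqP (Hy _ _)) //.
    by rewrite memJ_norm ?nG.
  by rewrite [coset N (s _)]sxy phiM // morphM ?nG // -sx -sy.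
pose HG := Group Hgroup.
have sHG : HG \subset G by apply/subsetP=> x /setIdP[].
have defH : HG :=: G.
  apply/eqP; rewrite eqEsubset sHG -(indexg_eq1 G HG).
  apply/negPn/negP=> neq1.
  have /pdivP[p p_pr p_dv] : 1 < #|G : HG| by rewrite ltn_neqAle eq_sym neq1 /=.
  have [P [sNP sPG sylP]] := Sylow_quotient_lift p.
  rewrite p'natE // => /negP[]; apply: dvdn_trans p_dv _.
  apply: indexgS; apply/subsetP=> x Px; have Gx := subsetP sPG x Px.
  rewrite inE Gx; apply/forall_inP=> n Nn; apply/eqP.
  have [Gsx sx] := mem_coset_lift Gx.
  exact: (restriction_lifts_conj sNP sPG (liftP p P _ _ _ _)).
move=> x y n Gx Gy yphi Nn.
have [Gsx sx] := mem_coset_lift Gx.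
rewrite (@eq_coset_conj y (s x)) //; last by rewrite [RHS]sx.
by move: (Gx); rewrite -{1}defH inE => /andP[_ /forall_inP/(_ n Nn)/eqP].
Qed.

(** * The obstruction class in H^2(G / N, N) *)

Hypothesis phi_compat : conj_compatible.

Import FiniteModule GRing.Theory.

Local Notation fmodN := (fmod_of abN).

(** The last condition makes the defect constant on cosets of [N] in its first argument and, through
    [phi_compat], in its second. *)
Definition set_lift g :=
  [/\ {in G, forall x, g x \in G},
      {in G, forall x, coset N (g x) = phi (coset N x)}
    & {in N & G, forall n x, g (n * x) = n * g x}].

Definition defect g x y : fmodN := fmod abN ((g x * g y)^-1 * g (x * y)).

(* The k-th multiple of the class of the defect vanishes in H^2(G / N, N); the
   first condition says that h is a cochain on G / N rather than on G. *)
Definition defect_coboundary g k := exists h : gT -> fmodN,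
  {in N & G, forall n x, h (n * x) = h x} /\
  {in G &, forall x y, h y + h x ^@ y = defect g x y *+ k + h (x * y)%g}%R.

Lemma coset_eq_divN x y : x \in G -> y \in G -> coset N x = coset N y ->
  x^-1 * y \in N.
Proof.
move=> Gx Gy eq_xy; apply: coset_idr; first by rewrite groupM ?groupV ?nG.
by rewrite morphM ?morphV ?groupV ?nG //= eq_xy mulVg.
Qed.

Lemma set_lift_defect g : set_lift g ->
  {in G &, forall x y, g (x * y) = g x * g y * val (defect g x y)}.
Proof.
move=> [gG gphi _] x y Gx Gy; rewrite /= fmodK ?mulKVg //.
apply: coset_eq_divN; rewrite ?(groupM, gG) //.
by rewrite morphM ?nG ?gG //= !gphi ?groupM ?phiM.
Qed.

Lemma set_lift_actr g x (u : fmodN) : set_lift g -> x \in G ->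
  (u ^@ g x = u ^@ x)%R.
Proof.
move=> [gG gphi _] Gx; apply: val_inj; rewrite /= !fmvalJ ?nG ?gG //.
by apply: phi_compat; rewrite ?gG ?gphi ?fmodP.
Qed.

Lemma defect_coboundary_lift g g' k :
  set_lift g -> set_lift g' -> defect_coboundary g k -> defect_coboundary g' k.
Proof.
move=> lg lg' [h [hN hG]]; have [gG gphi gN] := lg; have [gG' gphi' gN'] := lg'.
pose u x : fmodN := fmod abN ((g x)^-1 * g' x).
have g'E : {in G, forall x, g' x = g x * val (u x)}.
  move=> x Gx; rewrite /= fmodK ?mulKVg //.
  by rewrite coset_eq_divN ?gG ?gG' // gphi ?gphi'.
have u_defect : {in G &, forall x y,
    u y + u x ^@ y + defect g' x y = defect g x y + u (x * y)%g}%R.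
  move=> x y Gx Gy; apply: val_inj; apply: (mulgI (g x * g y)).
  rewrite [in RHS]fmvalA [RHS]mulgA -set_lift_defect // -g'E ?groupM //.
  rewrite (set_lift_defect lg') // !g'E // -(set_lift_actr (u x) lg Gy).
  rewrite (addrC (u y)) 2![in LHS]fmvalA fmvalJ ?nG ?gG // !mulgA.
  by rewrite mulgK.
(* The two defects differ by the coboundary of [u], taken k times here. *)
exists (fun x => h x - u x *+ k)%R; split=> [n x Nn Gx|x y Gx Gy].
  by rewrite hN // /u gN // gN' // invMg mulgA mulgKV.
have -> : defect g' x y = (defect g x y + u (x * y)%g - (u y + u x ^@ y))%R.
  by rewrite -u_defect // addrC addKr.
rewrite actAr actNr actZr mulrnBl !mulrnDl.
rewrite addrACA hG // -opprD.
by rewrite [RHS]addrAC; congr (_ - _)%R; rewrite addrACA subrr addr0.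
Qed.

Lemma defect_coboundary_gcd g a b : 0 < a ->
  defect_coboundary g a -> defect_coboundary g b ->
  defect_coboundary g (gcdn a b).
Proof.
move=> a_gt0 [h [hN hG]] [h' [hN' hG']]; have [u v uv _] := egcdnP b a_gt0.
(* Bezout coefficients: u * a = v * b + gcd(a, b). *)
exists (fun x => h x *+ u - h' x *+ v)%R; split=> [n x Nn Gx|x y Gx Gy].
  by rewrite hN ?hN'.
have def_gcd : (defect g x y *+ gcdn a b =
    defect g x y *+ a *+ u - defect g x y *+ b *+ v)%R.
  by rewrite -!mulrnA mulnC uv mulrnDr (mulnC b) addrC addKr.
rewrite def_gcd actAr actNr !actZr addrACA -opprD -!mulrnDl hG // hG' //.
by rewrite !mulrnDl opprD addrACA.
Qed.

Lemma defect_coboundary_index P :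
    N \subset P -> P \subset G -> restriction_lifts P phi ->
  exists2 g, set_lift g & defect_coboundary g #|G : P|.
Proof.
move=> sNP sPG [_ [c [AutPc cN cphi]]]; have PG := subsetP sPG.
have cM : {in P &, {morph c : x y / x * y}}.
  exact: (morphicP (Aut_morphic AutPc)).
have cP x : x \in P -> c x \in P by apply: Aut_closed.
pose rP x := repr (P :* x); pose pP x := x * (rP x)^-1.
have PpP x : pP x \in P by rewrite -mem_rcoset rcoset_repr rcoset_refl.
have rPmul x y : x \in P -> rP (x * y) = rP y.
  by move=> Px; rewrite /rP rcosetM (rcoset_id Px).
have rPG x : x \in G -> rP x \in G.
  by move=> Gx; rewrite -(groupMl _ (PG _ (PpP x))) mulgKV.
(* Writing [x] as [pP x * rP x], the lift [c] is used on the [P]-part and an arbitrary lift of [phi]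
   on the coset representative. *)
pose g x := c (pP x) * repr (phi (coset N (rP x))).
have g_mul x y : x \in P -> g (x * y) = c x * g y.
  by move=> Px; rewrite /g /pP rPmul // -mulgA cM ?PpP // mulgA.
have lg : set_lift g.
  split=> [x Gx|x Gx|n x Nn Gx].
  - by rewrite groupM ?(PG _ (cP _ _)) // (mem_coset_lift (rPG x Gx)).1.
  - have [Gs s] := mem_coset_lift (rPG x Gx).
    rewrite morphM ?nG ?(PG _ (cP _ _)) //= s cphi //.
    rewrite -phiM ?rPG ?(PG _ (PpP _)) //.
    by rewrite mulgKV.
  by rewrite g_mul ?cN // (subsetP sNP).
exists g => //; have [gG gphi gN] := lg.
have f_mul x y z : x \in P -> defect g (x * y) z = defect g y z.
  move=> Px; congr fmod; rewrite -(mulgA x) !(g_mul x) //.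
  by rewrite -mulgA invMg -mulgA mulKg.
have f_mulN x y n : x \in G -> y \in G -> n \in N ->
    defect g x (n * y) = defect g x y.
  move=> Gx Gy Nn; congr fmod.
  have Nn' : n ^ x^-1 \in N by rewrite memJ_norm ?groupV ?nG.
  have -> : x * (n * y) = n ^ x^-1 * (x * y).
    by rewrite conjgE invgK -!mulgA mulKg.
  (* By compatibility, [g x] moves past [n] as [x] does. *)
  have gxn : g x * n = n ^ x^-1 * g x.
    by rewrite [RHS]conjgC (phi_compat Gx (gG x Gx) (gphi x Gx) Nn') conjgKV.
  rewrite (gN n) // (gN _ _ Nn' (groupM Gx Gy)) (mulgA (g x)) gxn.
  by rewrite -(mulgA _ (g x)) invMg -mulgA mulKg.
pose h y := (\sum_(Px in rcosets P G) defect g (repr Px) y)%R.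
have repr_rcosetG x : x \in G -> repr (P :* x) \in G by apply: rPG.
exists h; split=> [n y Nn Gy|y z Gy Gz].
  by apply: eq_bigr => _ /rcosetsP[x Gx ->]; rewrite f_mulN ?repr_rcosetG.
(* Both sides come from expanding [g] at the product of x, y, z under its two bracketings. *)
have cocycle x : x \in G ->
    (defect g (x * y)%g z + defect g x y ^@ z
       = defect g y z + defect g x (y * z)%g)%R.
  move=> Gx; apply: val_inj; apply: (mulgI (g x * g y * g z)).
  rewrite -(set_lift_actr _ lg Gz) addrC [in LHS]fmvalA fmvalJ ?nG ?gG //.
  rewrite mulgA -(mulgA _ (g z)) -conjgC mulgA -!set_lift_defect ?groupM //.
  rewrite mulgA -(mulgA x) -2!(mulgA (g x)) -!set_lift_defect ?groupM //.
rewrite /= (actr_sum z) /=.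
(* Right translation by [y] permutes the cosets; it sends representatives to representatives up to
   left factors in [P], which [f_mul] ignores. *)
have -> : (h z = \sum_(Px in rcosets P G) defect g (repr Px * y)%g z)%R.
  rewrite /h (reindex_acts _ (actsRs_rcosets P G) Gy) /=.
  apply: eq_bigr => _ /rcosetsP[x Gx /= ->].
  rewrite rcosetE -rcosetM.
  case: repr_rcosetP=> p1 Pp1; case: repr_rcosetP=> p2 Pp2.
  by rewrite -mulgA [x * y]lock !f_mul.
rewrite -sumr_const -!big_split /=; apply: eq_bigr => _ /rcosetsP[x Gx ->].
by rewrite -cocycle ?repr_rcosetG.
Qed.

Lemma defect_coboundary1_lifts g :
  set_lift g -> defect_coboundary g 1 -> restriction_lifts G phi.
Proof.
move=> lg [h [hN hG]]; have [gG gphi gN] := lg.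
(* Correcting [g] by the cochain that bounds its defect gives a homomorphism. *)
pose f x := g x * val (h x).
have Gh x : val (h x) \in G by rewrite NG ?fmodP.
have fM : {in G &, {morph f : x y / x * y}}.
  move=> x y Gx Gy; rewrite /f (set_lift_defect lg) // -!mulgA; congr (_ * _).
  rewrite -fmvalA -[X in (X + _)%R]mulr1n -hG // addrC fmvalA.
  rewrite -(set_lift_actr _ lg Gy) fmvalJ ?nG ?gG //.
  by rewrite mulgA -conjgC -mulgA.
(* [g 1] need not be 1, but g(1) h(1) = 1, whence f(n) = n g(1) h(1) = n on [N]. *)
have f1 : f 1 = 1 by apply: (mulgI (f 1)); rewrite -fM // !mulg1.
apply: (restriction_lifts_intro (f := f)) => // [x Gx|n Nn|x Gx].
- by rewrite groupM ?gG.
- by rewrite -[n]mulg1 /f gN // hN // -mulgA [g 1 * _]f1 mulg1.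
by rewrite /f coset_kerr ?fmodP ?gphi.
Qed.

Lemma Sylow_restrictions_lift :
    (forall p P, prime p -> N \subset P -> P \subset G ->
       p.-Sylow(G / N) (P / N) -> restriction_lifts P phi) ->
  restriction_lifts G phi.
Proof.
move=> liftP.
(* The prime 2 is an arbitrary choice, made only to obtain some lift [g]. *)
have [P0 [sNP0 sP0G sylP0 _]] := Sylow_quotient_lift 2.
have [g lg _] :=
  defect_coboundary_index sNP0 sP0G (liftP 2 P0 isT sNP0 sP0G sylP0).
apply: (defect_coboundary1_lifts lg).
have kN : defect_coboundary g #|N|.
  exists (fun _ => 0%R); split=> // x y Gx Gy; rewrite act0r !addr0.
  by apply: val_inj; rewrite fmvalZ expg_cardG ?fmodP.
(* Starting from |N|, which kills [N], a multiple k > 1 with prime factor p is replaced by its gcd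
   with an index prime to p, a smaller number. *)
suff descent k : 0 < k -> defect_coboundary g k -> defect_coboundary g 1.
  exact: descent kN.
elim/ltn_ind: k => k IHk k_gt0 kS.
have [k_gt1|] := ltnP 1 k; last first.
  by move=> k_le1; have <- : k = 1%N by apply/eqP; rewrite eqn_leq k_le1.
have [p p_pr p_dv] := pdivP k_gt1.
have [P [sNP sPG sylP p'P]] := Sylow_quotient_lift p.
have [g' lg' kP] :=
  defect_coboundary_index sNP sPG (liftP p P p_pr sNP sPG sylP).
apply: (IHk (gcdn k #|G : P|)); rewrite ?gcdn_gt0 ?k_gt0 //.
  rewrite ltn_neqAle dvdn_leq ?dvdn_gcdl // andbT.
  apply: contraL p'P => /eqP eq_k; rewrite p'natE // negbK.
  by apply: dvdn_trans p_dv _; rewrite -eq_k dvdn_gcdr.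
by apply: defect_coboundary_gcd => //; apply: defect_coboundary_lift kP.
Qed.

End Lifting.

Theorem corollary6 (gT : finGroupType) (G N : {group gT})
    (abN : abelian N) (nNG : N <| G)
    (phi : {perm coset_of N}) (cphi : commuting_aut (G / N)%G phi) :
  restriction_lifts G phi <->
  (forall (p : nat) (P : {group gT}),
     prime p -> N \subset P -> P \subset G -> p.-Sylow(G / N) (P / N) ->
     restriction_lifts P phi).
Proof.
have AutKphi : phi \in Aut (G / N) by case: cphi.
split=> [[_ [c [AutGc cN cphiN]]] p P _ sNP sPG sylP | liftP]; last first.
  apply: (Sylow_restrictions_lift abN) => //.
  exact: conj_compatible_Sylow.
have PG := subsetP sPG.
have nN x : x \in G -> x \in 'N(N) by apply/subsetP/normal_norm.
have nNP : N <| P := normalS sNP sPG nNG.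
apply: (restriction_lifts_intro nNG AutKphi (f := c)) => // [|x Px|x Px].
- by apply: sub_in2 PG _ (morphicP (Aut_morphic AutGc)).
- have Gcx : c x \in G by rewrite Aut_closed ?PG.
  (* [c x] lies in [P], the preimage of P / N, because the commuting automorphism [phi] stabilizes
     this Sylow subgroup. *)
  rewrite -(quotientGK nNP) mem_morphpre ?nN //= cphiN ?PG //.
  by rewrite -(commuting_aut_Sylow cphi sylP) imset_f ?mem_quotient.
by rewrite cphiN ?PG.
Qed.
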